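(* For each integer $N\ge 3$ let $p=p_N=N^{-3/4}$, let $G(N,p)$ be the random graph on $N$ vertices in which each of the $n=\binom{N}{2}$ possible edges is present independently with probability $p$, let $K_N$ denote the number of triangles of $G(N,p)$, and let $\mu_N=\mathbb{E}[K_N]=\binom{N}{3}p^3$. Then there exist a sequence $(t_N)_N$ of positive reals with $t_N=o(\mu_N)$ as $N\to\infty$ and an integer $N_0$ such that for all $N\ge N_0$ $$\Pr\big[\,|K_N-\mu_N|\ge t_N\,\big]<\exp\left(-N^{1/13}\right).$$
   Context: A triangle is a set of three distinct vertices that are pairwise joined by edges. *)

(* Defs.v *)
From mathcomp Require Import all_boot all_order all_algebra.
From mathcomp Require Import all_classical all_reals all_analysis.

Set Implicit Arguments.
Unset Strict Implicit.
Unset Printing Implicit Defensive.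

Import Order.TTheory GRing.Theory Num.Theory.

Local Open Scope ring_scope.

(* A simple graph on the vertex set 'I_N is identified with its edge set, a
   subset of [all_edges N]; an edge is an unordered pair of distinct vertices. *)
Definition all_edges (N : nat) : {set {set 'I_N}} :=
  [set e : {set 'I_N} | #|e| == 2].

Lemma card_all_edges (N : nat) : #|all_edges N| = 'C(N, 2).
Proof. by rewrite card_draws card_ord. Qed.

Definition triangles (N : nat) (G : {set {set 'I_N}}) : {set {set 'I_N}} :=
  [set T : {set 'I_N} | (#|T| == 3) &&
     [forall x in T, forall y in T, (x != y) ==> ([set x; y]%SET \in G)]].

Definition num_triangles (N : nat) (G : {set {set 'I_N}}) : nat :=
  #|triangles G|.

(* The law of G(N,p): the product, over all possible edges, of the Bernoulli(p)
   law of the presence of that edge; a distribution on subsets of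
   [all_edges N]. *)
Definition gnp_mass (R : realType) (N : nat) (p : R) (G : {set {set 'I_N}}) : R :=
  \prod_(e in all_edges N) (if e \in G then p else 1 - p).

Definition gnp_pr (R : realType) (N : nat) (p : R)
    (A : pred {set {set 'I_N}}) : R :=
  \sum_(G in powerset (all_edges N) | A G) gnp_mass p G.

Definition gnp_expect (R : realType) (N : nat) (p : R)
    (X : {set {set 'I_N}} -> R) : R :=
  \sum_(G in powerset (all_edges N)) gnp_mass p G * X G.

Definition edge_prob (R : realType) (N : nat) : R := N%:R `^ (- (3 / 4)).

Definition mu (R : realType) (N : nat) : R :=
  gnp_expect (edge_prob R N) (fun G : {set {set 'I_N}} => (num_triangles G)%:R).

(* Any prescribed set F of possible edges is present with probability
   p ^ #|F|; F = set0 gives total mass 1. *)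
Lemma gnp_pr_supset (R : realType) (N : nat) (p : R) (F : {set {set 'I_N}}) :
  F \subset all_edges N -> gnp_pr p (fun G => F \subset G) = p ^+ #|F|.
Proof.
move=> FE; pose E := all_edges N.
pose a e : R := if e \in E then p else 0.
pose b e : R := if e \in E then if e \in F then 0 else 1 - p else 1.
have -> : p ^+ #|F| = \prod_e (a e + b e).
  rewrite -prodr_const big_mkcond /=; apply: eq_bigr => e _; rewrite /a /b.
  have [eF|eF] := boolP (e \in F); first by rewrite (fintype.subsetP FE) // addr0.
  by case: ifP => _; rewrite ?add0r // addrC subrK.
rewrite bigA_distr /gnp_pr [LHS]big_mkcond /=; apply: eq_bigr => G _.
rewrite powersetE -/E; case: ifP => [/andP[GE FG]|].
  rewrite /gnp_mass big_mkcond /=; apply: eq_bigr => e _; rewrite -/E /a /b.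
  have [eE|eE] := boolP (e \in E).
    have [//|eG] := boolP (e \in G).
    by rewrite (negPf (contra (fintype.subsetP FG e) eG)).
  by rewrite (negPf (contra (fintype.subsetP GE e) eE)).
move=> /negbT; rewrite negb_and => /orP[] /fintype.subsetPn[e e1 e2];
  rewrite (bigD1 e) //= /a /b.
  by rewrite e1 (negPf e2) mul0r.
by rewrite (negPf e2) e1 (fintype.subsetP FE) // mul0r.
Qed.

Lemma mem_triangles (N : nat) (G : {set {set 'I_N}}) (U : {set 'I_N}) :
  (U \in triangles G) = (#|U| == 3) &&
    ([set e : {set 'I_N} | (e \subset U) && (#|e| == 2)]%SET \subset G).
Proof.
rewrite inE; congr (_ && _); apply/forall_inP/fintype.subsetP => [H e|H x xU].
  rewrite inE => /andP[eU] /cards2P[x] [y] [xy ee]; subst e.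
  move: eU; rewrite finset.subUset !finset.sub1set => /andP[xU yU].
  by have /forall_inP /(_ _ yU) /implyP := H _ xU; apply.
apply/forall_inP => y yU; apply/implyP => xy; apply: H.
by rewrite inE finset.subUset !finset.sub1set xU yU cards2 xy.
Qed.

Lemma muE (R : realType) (N : nat) :
  mu R N = ('C(N, 3))%:R * edge_prob R N ^+ 3.
Proof.
set p := edge_prob R N; rewrite /mu /gnp_expect -/p.
pose F (U : {set 'I_N}) := [set e : {set 'I_N} | (e \subset U) && (#|e| == 2)]%SET.
transitivity (\sum_(U : {set 'I_N} | #|U| == 3)
    gnp_pr p (fun G : {set {set 'I_N}} => F U \subset G)).
  under [RHS]eq_bigr do rewrite /gnp_pr big_mkcondr /=.
  rewrite exchange_big /=; apply: eq_bigr => G _.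
  rewrite -big_mkcondr /= /num_triangles mulr_natr -sumr_const.
  by apply: eq_bigl => U; rewrite mem_triangles.
rewrite (eq_bigr (fun=> p ^+ 3)) => [|U /eqP U3].
  rewrite sumr_const mulr_natl; congr (_ *+ _).
  by rewrite -[in RHS](card_ord N) -card_draws; apply: eq_card => U; rewrite !inE.
rewrite gnp_pr_supset ?cards_draws ?U3 //.
by apply/fintype.subsetP => e; rewrite !inE => /andP[].
Qed.

(* Main.v *)
Require Import Defs.
From mathcomp Require Import all_boot all_order all_algebra.
From mathcomp Require Import all_classical all_reals all_analysis.
From mathcomp Require Import ring lra zify.
(* Last, so that the finset names win over those of classical_sets. *)
From mathcomp Require Import fintype finset.

Set Implicit Arguments.
Unset Strict Implicit.
Unset Printing Implicit Defensive.

Import Order.TTheory GRing.Theory Num.Theory.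
Import numFieldNormedType.Exports.

(* Let K be the number of triangles and mu = E K.  For a set A of edges, the
   expected number of triangles meeting A, given that A is present, is at most
   |A| N p^2 + |A|^2 <= 2 |A|^2, since a triangle sharing two edges with A is
   determined by them.

   Upper tail: adding one triangle at a time to a union of at most m triangles
   gives E K^m <= (mu + 18 m^2)^m; apply Markov's inequality with m ~ N^(1/4).

   Lower tail: this is Janson's inequality.  Its usual proof bounds E(K r^K)
   from below in terms of E(r^K) with the Harris inequality.  Here p is small
   enough for a simpler comparison: deleting from G the at most six edges of two
   triangles amounts to conditioning on an event of probability (1-p)^6 >= 1/2,
   so E(r^K) loses at most a factor 2.  Iterating along r = (1+h)^(-j),
   j <= N^(3/8), replaces the integration of the logarithmic derivative.

   With deviation N^(-1/8) mu both tails are at most exp(-N^(1/8)/32). *)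

Local Open Scope ring_scope.

(** * Expectation under the law of [G(N,p)] *)

Section Expectation.
Context {R : realType} {N : nat} (p : R).
Implicit Types (G F A : {set {set 'I_N}}) (e : {set 'I_N}).
Implicit Types X Y f : {set {set 'I_N}} -> R.

Lemma eq_gnp_expect X Y :
  (forall G, G \subset all_edges N -> X G = Y G) ->
  gnp_expect p X = gnp_expect p Y.
Proof.
by move=> XY; apply: eq_bigr => G; rewrite powersetE => GD; rewrite XY.
Qed.

Lemma gnp_expectD X Y :
  gnp_expect p (fun G => X G + Y G) = gnp_expect p X + gnp_expect p Y.
Proof. by rewrite -big_split /=; apply: eq_bigr => G _; rewrite mulrDr. Qed.

Lemma gnp_expectZ c X :
  gnp_expect p (fun G => c * X G) = c * gnp_expect p X.
Proof. by rewrite mulr_sumr; apply: eq_bigr => G _; rewrite mulrCA. Qed.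

Lemma gnp_expect_sum (J : finType) (P : pred J) (X : J -> {set {set 'I_N}} -> R) :
  gnp_expect p (fun G => \sum_(j | P j) X j G) =
  \sum_(j | P j) gnp_expect p (X j).
Proof.
rewrite exchange_big /=; apply: eq_bigr => G _.
by rewrite mulr_sumr.
Qed.

Lemma gnp_expect1 : gnp_expect p (fun _ : {set {set 'I_N}} => 1) = 1.
Proof.
have := gnp_pr_supset p (sub0set (all_edges N)).
rewrite cards0 expr0 => pr1; rewrite -[RHS]pr1.
apply: eq_big => [G|G _]; last by rewrite mulr1.
by rewrite sub0set andbT.
Qed.

Lemma big_powersetD1 e (g : {set {set 'I_N}} -> R) : e \in all_edges N ->
  \sum_(G in powerset (all_edges N)) g G =
  \sum_(G in powerset (all_edges N :\ e)) (g G + g (e |: G)).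
Proof.
move=> eD; rewrite (bigID (fun G => e \in G)) /= addrC big_split /=; congr (_ + _).
  by apply: eq_bigl => G; rewrite !powersetE subsetD1.
rewrite (reindex_onto (fun G => e |: G) (fun G => G :\ e)) /=; last first.
  by move=> G /andP[_ eG]; rewrite setD1K.
apply: eq_bigl => G; rewrite !powersetE setU11 andbT subUset sub1set eD /=.
rewrite subsetD1; congr (_ && _).
apply/eqP/idP => [<-|eG]; first by rewrite setD11.
by rewrite setU1K.
Qed.

(** Conditioning on the state of one edge: [e |: G] and [G :\ e] both forget it, so the graphs that
    differ only at [e] can be paired. *)
Lemma gnp_expect_resample e X : e \in all_edges N ->
  gnp_expect p X = p * gnp_expect p (fun G => X (e |: G)) +
                   (1 - p) * gnp_expect p (fun G => X (G :\ e)).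
Proof.
move=> eD; rewrite -!gnp_expectZ -gnp_expectD /gnp_expect !(big_powersetD1 _ eD).
apply: eq_bigr => G; rewrite powersetE subsetD1 => /andP[GD eG].
pose w := \prod_(e' in all_edges N | e' != e) (if e' \in G then p else 1 - p).
have -> : gnp_mass p G = (1 - p) * w.
  by rewrite /gnp_mass (bigD1 e) //= (negPf eG).
have -> : gnp_mass p (e |: G) = p * w.
  rewrite /gnp_mass (bigD1 e) //= setU11; congr (_ * _).
  by apply: eq_bigr => e' /andP[_ /negPf ne]; rewrite in_setU1 ne.
rewrite setUA setUid setU1K //.
have -> : G :\ e = G.
  by apply/setDidPl; rewrite disjoint_sym disjoints1.
by ring.
Qed.

(** Independence: [f] ignores the edges of [F]. These are resampled one by one, and the term in
    which such an edge is absent vanishes. *)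
Lemma gnp_expect_supset F f : F \subset all_edges N ->
  (forall e G, e \in F -> f (e |: G) = f G) ->
  gnp_expect p (fun G => (F \subset G)%:R * f G) = p ^+ #|F| * gnp_expect p f.
Proof.
have [n] := ubnP #|F|; elim: n F => // n IHn F; rewrite ltnS => Fn FD fF.
have [->|[e eF]] := set_0Vmem F.
  by rewrite cards0 mul1r; apply: eq_gnp_expect => G _; rewrite sub0set mul1r.
have eD := subsetP FD _ eF.
rewrite (gnp_expect_resample _ eD) [X in _ + _ * X](_ : _ = 0); last first.
  apply: big1 => G _; suff -> : F \subset G :\ e = false by rewrite mul0r mulr0.
  by apply/negP => /subsetP/(_ _ eF); rewrite setD11.
rewrite mulr0 addr0 (cardsD1 e) eF exprS -mulrA; congr (_ * _).
rewrite -IHn; first last.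
- by move=> e' G; rewrite in_setD1 => /andP[_]; apply: fF.
- by rewrite (subset_trans _ FD) // subD1set.
- by rewrite (cardsD1 e) eF in Fn.
by apply: eq_gnp_expect => G _; rewrite fF // subDset.
Qed.

Hypotheses (p0 : 0 <= p) (p1 : p <= 1).

Lemma gnp_mass_ge0 G : 0 <= gnp_mass p G.
Proof. by apply: prodr_ge0 => e _; case: ifP; rewrite ?subr_ge0. Qed.

Lemma ler_gnp_expect X Y :
  (forall G, G \subset all_edges N -> X G <= Y G) ->
  gnp_expect p X <= gnp_expect p Y.
Proof.
move=> XY; apply: ler_sum => G; rewrite powersetE => GD.
by rewrite ler_wpM2l ?gnp_mass_ge0 ?XY.
Qed.

Lemma gnp_expect_ge0 X : (forall G, 0 <= X G) -> 0 <= gnp_expect p X.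
Proof. by move=> X0; apply: sumr_ge0 => G _; rewrite mulr_ge0 ?gnp_mass_ge0. Qed.

(** The left side is the part of the expectation of [f] carried by the graphs that avoid [F]; the
    other graphs contribute a nonnegative amount. *)
Lemma gnp_expect_setD F f : F \subset all_edges N -> (forall G, 0 <= f G) ->
  (1 - p) ^+ #|F| * gnp_expect p (fun G => f (G :\: F)) <= gnp_expect p f.
Proof.
have [n] := ubnP #|F|; elim: n F f => // n IHn F f; rewrite ltnS => Fn FD f0.
have [->|[e eF]] := set_0Vmem F.
  by rewrite cards0 mul1r; apply: ler_gnp_expect => G _; rewrite setD0.
have eD := subsetP FD _ eF.
rewrite (gnp_expect_resample f eD) (cardsD1 e) eF exprS -mulrA.
rewrite -[leLHS]add0r; apply: lerD.
  by rewrite mulr_ge0 // gnp_expect_ge0.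
rewrite ler_wpM2l ?subr_ge0 //.
have FG G : G :\: F = (G :\: (F :\ e)) :\ e.
  by rewrite setDDl setUC setD1K.
under eq_gnp_expect do rewrite FG.
apply: (IHn _ (fun G => f (G :\ e))) => //.
- by rewrite (cardsD1 e) eF in Fn.
- by rewrite (subset_trans _ FD) // subD1set.
Qed.

Lemma gnp_markov (A : pred {set {set 'I_N}}) (c : R) X :
  (forall G, 0 <= X G) -> (forall G, A G -> c <= X G) ->
  c * gnp_pr p A <= gnp_expect p X.
Proof.
move=> X0 AX; rewrite /gnp_pr mulr_sumr /gnp_expect [leRHS](bigID A) /=.
rewrite -[leLHS]addr0 lerD //.
  by apply: ler_sum => G /andP[_ AG]; rewrite mulrC ler_wpM2l ?gnp_mass_ge0 ?AX.
by apply: sumr_ge0 => G _; rewrite mulr_ge0 ?gnp_mass_ge0.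
Qed.

Lemma gnp_pr_le_orb (A B C : pred {set {set 'I_N}}) :
  (forall G, A G -> B G || C G) -> gnp_pr p A <= gnp_pr p B + gnp_pr p C.
Proof.
move=> ABC; rewrite /gnp_pr !big_mkcondr /= -big_split /=; apply: ler_sum => G _.
have := gnp_mass_ge0 G; have := ABC G.
by case: (A G) => [/(_ isT)|_]; case: (B G); case: (C G) => //=; lra.
Qed.

End Expectation.

(** * Copies from a general family of edge sets: moments and Janson's inequality *)

Definition copies (N : nat) (J : finType) (S : {set J})
    (F : J -> {set {set 'I_N}}) (G : {set {set 'I_N}}) : nat :=
  #|[set j in S | F j \subset G]|.

Section Copies.
Context {R : realType} {N : nat} {J : finType}.
Variables (p : R) (S : {set J}) (F : J -> {set {set 'I_N}}).
Hypotheses (p0 : 0 <= p) (p1 : p <= 1).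
Hypothesis FD : forall j, j \in S -> F j \subset all_edges N.
Implicit Types (G A : {set {set 'I_N}}).

Local Notation E := (gnp_expect p).
Local Notation K := (copies S F).

Definition copies_mean : R := \sum_(j in S) p ^+ #|F j|.

(* The conditional mean, given that A is present, of the number of copies
   meeting A. *)
Definition copies_meeting A : R :=
  \sum_(j in S | ~~ [disjoint F j & A]) p ^+ #|F j :\: A|.

Lemma copiesE G : (K G)%:R = \sum_(j in S) (F j \subset G)%:R :> R.
Proof.
rewrite /copies -sum1_card natr_sum (eq_bigl (fun j => (j \in S) && (F j \subset G))).
  by rewrite big_mkcondr /=; apply: eq_bigr => j _; case: ifP.
by move=> j; rewrite inE.
Qed.

Lemma copies_subset G A : G \subset A -> (K G <= K A)%N.
Proof.
move=> GA; apply/subset_leq_card/subsetP => j; rewrite !inE => /andP[-> /=].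
by move=> FG; apply: subset_trans GA.
Qed.

Lemma copies_setD G A :
  (K G <= K (G :\: A) + \sum_(j in S | ~~ [disjoint F j & A]) (F j \subset G))%N.
Proof.
rewrite /copies -!sum1_card !(eq_bigl _ _ (fun j => in_set _ j)) !big_mkcondr /=.
rewrite -big_split /=; apply: leq_sum => j _.
by rewrite subsetD; case: (F j \subset G); case: [disjoint _ & _].
Qed.

Lemma cards_setU_D (T : finType) (A B : {set T}) : #|A :|: B| = (#|A| + #|B :\: A|)%N.
Proof. by rewrite cardsU cardsD setIC addnBA // subset_leq_card // subsetIl. Qed.

Lemma sum_copies_extending A :
  \sum_(j in S) p ^+ #|F j :\: A| <= copies_mean + copies_meeting A.
Proof.
rewrite (bigID (fun j => [disjoint F j & A])) /= lerD2r.
rewrite /copies_mean big_mkcondr /=; apply: ler_sum => j _.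
case: ifP => [/setDidPl -> //|_]; exact: exprn_ge0.
Qed.

(** The set [A] makes the induction on [m] work: expanding one factor of the power over the copies
    [j] replaces [A] by [A :|: F j], and summing over [j] costs a factor [copies_mean + M]. Each
    round adds at most three edges, whence the size bound [#|A| + 3 * m]. *)
Lemma copies_moment_supset A (M : R) m :
  A \subset all_edges N ->
  (forall j, j \in S -> #|F j| <= 3)%N ->
  (forall B : {set {set 'I_N}}, B \subset all_edges N -> (#|B| <= #|A| + 3 * m)%N ->
     copies_meeting B <= M) ->
  E (fun G => (A \subset G)%:R * (K G)%:R ^+ m) <=
  p ^+ #|A| * (copies_mean + M) ^+ m.
Proof.
move=> AD F3; elim: m A AD => [|m IHm] A AD MA.
  by rewrite expr0 -[X in _ <= _ * X](gnp_expect1 (N := N) p) -gnp_expect_supset.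
have nuM : 0 <= copies_mean + M.
  apply: le_trans (lerD (lexx _) (MA A AD (leq_addr _ _))).
  by rewrite addr_ge0 // sumr_ge0 // => j _; rewrite exprn_ge0.
have -> : E (fun G => (A \subset G)%:R * (K G)%:R ^+ m.+1) =
  \sum_(j in S) E (fun G => (A :|: F j \subset G)%:R * (K G)%:R ^+ m).
  rewrite -gnp_expect_sum; apply: eq_gnp_expect => G _.
  rewrite exprS copiesE mulrA mulr_sumr mulr_suml; apply: eq_bigr => j _.
  by rewrite subUset -natrM mulnb.
apply: (@le_trans _ _ (\sum_(j in S)
    p ^+ #|A :|: F j| * (copies_mean + M) ^+ m)).
  apply: ler_sum => j jS; apply: IHm; first by rewrite subUset AD FD.
  move=> B BD Bc; apply: MA => //; apply: leq_trans Bc _.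
  rewrite cards_setU_D mulnS addnA leq_add2r leq_add2l.
  by rewrite (leq_trans _ (F3 _ jS)) // subset_leq_card // subsetDl.
rewrite -mulr_suml exprS mulrA ler_wpM2r ?exprn_ge0 //.
under eq_bigr do rewrite cards_setU_D exprD.
rewrite -mulr_sumr ler_wpM2l ?exprn_ge0 //.
by rewrite (le_trans (sum_copies_extending A)) // lerD2l MA // leq_addr.
Qed.

Lemma copies_moment (M : R) m :
  (forall j, j \in S -> #|F j| <= 3)%N ->
  (forall B : {set {set 'I_N}}, B \subset all_edges N -> (#|B| <= 3 * m)%N ->
     copies_meeting B <= M) ->
  E (fun G => (K G)%:R ^+ m) <= (copies_mean + M) ^+ m.
Proof.
move=> F3 HM; have := @copies_moment_supset set0 M m (sub0set _) F3.
rewrite cards0 add0n expr0 mul1r => /(_ HM); apply: le_trans.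
by apply: ler_gnp_expect => // G _; rewrite sub0set mul1r.
Qed.

Lemma bernoulli_exprn (r : R) n : 0 <= r -> r <= 1 -> 1 - (1 - r) * n%:R <= r ^+ n.
Proof.
move=> r0 r1; elim: n => [|n IHn]; first by rewrite mulr0 subr0.
rewrite exprS; apply: (@le_trans _ _ (r * (1 - (1 - r) * n%:R))).
  have n0 : 0 <= (1 - r) ^+ 2 * n%:R by rewrite mulr_ge0 ?sqr_ge0.
  by rewrite -natr1; move: n%:R n0 => x; lra.
by rewrite ler_wpM2l.
Qed.

(* Conditioning on the absence of A removes exactly the copies meeting A. *)
Lemma gnp_expect_copies_setD A (r : R) : 0 <= r -> A \subset all_edges N ->
  2^-1 <= (1 - p) ^+ #|A| ->
  E (fun G => r ^+ K (G :\: A)) <= 2 * E (fun G => r ^+ K G).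
Proof.
move=> r0 AD pA.
have r0' G : 0 <= r ^+ K G by rewrite exprn_ge0.
have a0 : 0 <= E (fun G => r ^+ K (G :\: A)) by exact: gnp_expect_ge0.
rewrite -ler_pdivrMl ?ltr0n //.
exact: le_trans (ler_wpM2r a0 pA) (gnp_expect_setD p0 p1 AD r0').
Qed.

(* Janson's differential inequality; the correlation inequality is replaced by
   [gnp_expect_copies_setD], at the cost of the factor 2. *)
Lemma janson_step (C r : R) : 0 <= r -> r <= 1 ->
  (forall i, i \in S -> copies_meeting (F i) <= C) ->
  (forall i j, i \in S -> j \in S -> 2^-1 <= (1 - p) ^+ #|F i :|: F j|) ->
  copies_mean * (1 - 2 * C * (1 - r)) * E (fun G => r ^+ K G) <=
  E (fun G => (K G)%:R * r ^+ K G).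
Proof.
move=> r0 r1 HC Hp; set phi := E _.
have phi0 : 0 <= phi by apply: gnp_expect_ge0 => // G; rewrite exprn_ge0.
have rmono G A : G \subset A -> r ^+ K A <= r ^+ K G.
  by move=> GA; rewrite ler_wiXn2l // copies_subset.
have setU1D G A B e : e \in A -> (e |: G) :\: (A :|: B) = G :\: (A :|: B).
  move=> eA; apply/setP => x; rewrite !inE; have [->|//] := eqVneq x e.
  by rewrite eA.
rewrite (_ : E _ = \sum_(i in S) E (fun G => (F i \subset G)%:R * r ^+ K G)); last first.
  rewrite -gnp_expect_sum; apply: eq_gnp_expect => G _.
  by rewrite copiesE mulr_suml.
rewrite -mulrA mulr_suml; apply: ler_sum => i iS.
pose T j := (j \in S) && ~~ [disjoint F j & F i].
(* On graphs containing [F i], Bernoulli's inequality splits off the copies meeting [F i]. Deleting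
   [F i :|: F j] can only raise [r ^+ K], and makes this factor independent of the edges required to
   be present. *)
apply: (@le_trans _ _ (E (fun G => (F i \subset G)%:R * r ^+ K (G :\: F i)
   - (1 - r) * \sum_(j | T j) (F i :|: F j \subset G)%:R *
                                r ^+ K (G :\: (F i :|: F j))))); last first.
  apply: ler_gnp_expect => // G _.
  have [FiG|_] := boolP (F i \subset G); last first.
    rewrite !mul0r sub0r oppr_le0 mulr_ge0 ?subr_ge0 //.
    by apply: sumr_ge0 => j _; rewrite mulr_ge0 // exprn_ge0.
  rewrite !mul1r.
  set Y := (\sum_(j in S | ~~ [disjoint F j & F i]) (F j \subset G))%N.
  have KY : (K G <= K (G :\: F i) + Y)%N by exact: copies_setD.
  apply: le_trans (_ : r ^+ (K (G :\: F i) + Y) <= _); last by rewrite ler_wiXn2l.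
  rewrite exprD.
  apply: le_trans (ler_wpM2l (exprn_ge0 _ r0) (bernoulli_exprn Y r0 r1)).
  rewrite mulrBr mulr1 lerD2l lerN2 mulrCA ler_wpM2l ?subr_ge0 //.
  rewrite /Y natr_sum mulr_sumr; apply: ler_sum => j _.
  by rewrite subUset FiG /= mulrC ler_wpM2l // rmono // setDS // subsetUl.
have EB (X Y : {set {set 'I_N}} -> R) :
    E (fun G => X G - (1 - r) * Y G) = E X - (1 - r) * E Y.
  rewrite -mulNr -gnp_expectZ -gnp_expectD; apply: eq_gnp_expect => G _.
  by rewrite mulNr.
rewrite (EB (fun G => (F i \subset G)%:R * r ^+ K (G :\: F i))
  (fun G => \sum_(j | T j) (F i :|: F j \subset G)%:R *
                           r ^+ K (G :\: (F i :|: F j)))).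
rewrite gnp_expect_supset ?FD //; last first.
  by move=> e G eF; rewrite -[F i]setUid setU1D.
rewrite gnp_expect_sum.
(* In the first term monotonicity suffices to undo the deletion; in the subtracted sum, undoing it
   costs the factor 2. *)
apply: (@le_trans _ _ (p ^+ #|F i| * phi - (1 - r) *
    \sum_(j | T j) p ^+ #|F i :|: F j| * (2 * phi))); last first.
  apply: lerB.
    rewrite ler_wpM2l ?exprn_ge0 // ler_gnp_expect // => G _.
    by rewrite rmono // subsetDl.
  rewrite ler_wpM2l ?subr_ge0 //; apply: ler_sum => j /andP[jS _].
  rewrite gnp_expect_supset ?subUset ?FD //; last first.
    by move=> e G eF; rewrite -[F i :|: F j]setUid setU1D.
  by rewrite ler_wpM2l ?exprn_ge0 // gnp_expect_copies_setD ?subUset ?FD ?Hp.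
under [\sum_(j | T j) _]eq_bigr do rewrite cards_setU_D exprD -mulrA.
rewrite -mulr_sumr -mulr_suml -/(copies_meeting (F i)).
have := HC _ iS; set c := copies_meeting _ => cC.
rewrite [leRHS](_ : _ = p ^+ #|F i| * ((1 - 2 * c * (1 - r)) * phi)); last first.
  by move: (p ^+ _) phi c {phi0 EB cC} => a b c; ring.
rewrite ler_wpM2l ?exprn_ge0 // ler_wpM2r // lerD2l lerN2 ler_wpM2r ?subr_ge0 //.
by rewrite ler_wpM2l.
Qed.

End Copies.

(** * Elementary inequalities for exponentials and powers *)

Lemma expR_sub_sqr_le (R : realType) (y : R) : 0 <= y -> expR (y - y ^+ 2) <= 1 + y.
Proof.
move=> y0; have := expR_ge1Dx (- (y - y ^+ 2)); rewrite expRN => H.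
rewrite -[leLHS]invrK -[leRHS]invrK lef_pV2 ?posrE ?invr_gt0 ?expR_gt0 //; last lra.
apply: le_trans H; rewrite -div1r ler_pdivrMr; last lra.
(* The product [(1 + y) * (1 - y + y ^+ 2)] equals [1 + y ^+ 3]. *)
have : 0 <= y ^+ 3 by rewrite exprn_ge0.
by lra.
Qed.

Lemma ler1D_exprn (R : realType) (h : R) n : 0 <= h -> 1 + h * n%:R <= (1 + h) ^+ n.
Proof.
move=> h0; elim: n => [|n IHn]; first by rewrite mulr0 addr0.
rewrite exprS; apply: le_trans (_ : (1 + h) * (1 + h * n%:R) <= _).
  have : 0 <= h ^+ 2 * n%:R by rewrite mulr_ge0 ?sqr_ge0.
  by rewrite -natr1; move: n%:R => x; lra.
by rewrite ler_wpM2l // addr_ge0.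
Qed.

(** One step of the lower tail: the left side is the cost in Markov's inequality,
    [1 + e * (1 - eta)] the gain. With [y = e * (1 - eta)], [y - y ^+ 2 >= e - e * (eta + e) >= e -
    e * (d / 2)]. *)
Lemma laplace_step_le (R : realType) (d e eta : R) :
  0 <= e -> 0 <= eta -> eta + e <= d / 2 -> eta <= 1 ->
  expR (e * (1 - d)) <= (1 + e * (1 - eta)) * expR (- (e * (d / 2))).
Proof.
move=> e0 eta0 ed eta1; set y := e * (1 - eta).
have y0 : 0 <= y by rewrite mulr_ge0 // subr_ge0.
apply: le_trans (ler_wpM2r (expR_ge0 _) (expR_sub_sqr_le y0)).
rewrite -expRD ler_expR.
have ye : y <= e by rewrite ler_piMr // gerBl.
have y2 : y ^+ 2 <= e * e by rewrite expr2 ler_pM.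
have : e * (eta + e) <= e * (d / 2) by rewrite ler_wpM2l.
by move: y2; rewrite /y; lra.
Qed.

(** * Upper and lower tails for a general family *)

Section Tails.
Context {R : realType} {N : nat} {J : finType}.
Variables (p : R) (S : {set J}) (F : J -> {set {set 'I_N}}).
Hypotheses (p0 : 0 <= p) (p1 : p <= 1).
Hypothesis FD : forall j, j \in S -> F j \subset all_edges N.

Local Notation E := (gnp_expect p).
Local Notation K := (copies S F).
Local Notation nu := (copies_mean p S F).

(** Markov's inequality for the [m]-th power: [(nu + M) / ((1 + d) * nu)] is at most
    [(1 + d / 4) / (1 + d)], hence at most [1 - d / 3] for [0 <= d <= 1]. *)
Lemma copies_upper_tail (M d : R) m :
  (forall j, j \in S -> #|F j| <= 3)%N ->
  (forall B : {set {set 'I_N}}, B \subset all_edges N -> (#|B| <= 3 * m)%N ->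
     copies_meeting p S F B <= M) ->
  0 < nu -> 0 <= d -> d <= 1 -> M <= d / 4 * nu ->
  gnp_pr p (fun G => (1 + d) * nu <= (K G)%:R) <= expR (- (m%:R * (d / 3))).
Proof.
move=> F3 HM nu0 d0 d1 Md.
have M0 : 0 <= M.
  have := HM set0 (sub0set _); rewrite cards0 => /(_ isT); apply: le_trans.
  by rewrite /copies_meeting sumr_ge0 // => j _; rewrite exprn_ge0.
have c0 : 0 < (1 + d) * nu by rewrite mulr_gt0 // ltr_wpDr.
have := gnp_markov p0 p1 (A := fun G => (1 + d) * nu <= (K G)%:R)
  (c := ((1 + d) * nu) ^+ m) (X := fun G => (K G)%:R ^+ m).
have mono G : (1 + d) * nu <= (K G)%:R -> ((1 + d) * nu) ^+ m <= (K G)%:R ^+ m.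
  by move=> KG; rewrite lerXn2r ?nnegrE ?ler0n ?(ltW c0).
move=> /(_ (fun G => exprn_ge0 _ (ler0n _ _)) mono) Mk.
have := le_trans Mk (copies_moment p0 p1 FD F3 HM).
rewrite mulrC -ler_pdivlMr ?exprn_gt0 // => /le_trans; apply.
rewrite -expr_div_n -mulrN expRM_natl; apply: lerXn2r.
- by rewrite nnegrE (divr_ge0 (addr_ge0 (ltW nu0) M0) (ltW c0)).
- by rewrite nnegrE expR_ge0.
apply: le_trans (expR_ge1Dx _); rewrite ler_pdivrMr //.
have: 0 <= d * (1 - d) * nu by rewrite !mulr_ge0 ?subr_ge0 // ltW.
by move: nu0 Md M0; move: nu => a; lra.
Qed.

(** Starting from the value 1 at [r = 1], each of the [n] divisions of [r] by [1 + h] divides the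
    expectation of [r ^+ K] by at least the base of the second power. *)
Lemma copies_laplace (C h : R) n :
  0 <= C -> 0 <= h -> 2 * C * (n%:R * h) <= 1 ->
  (forall i, i \in S -> copies_meeting p S F (F i) <= C) ->
  (forall i j, i \in S -> j \in S -> 2^-1 <= (1 - p) ^+ #|F i :|: F j|) ->
  E (fun G => ((1 + h)^-1 ^+ n) ^+ K G) *
    (1 + h * nu * (1 - 2 * C * (n%:R * h))) ^+ n <= 1.
Proof.
move=> C0 h0 ch1 HC Hp; set q := (1 + h)^-1; set z := 1 + _.
have h1 : 0 < 1 + h by rewrite ltr_wpDr.
have q0 : 0 <= q by rewrite invr_ge0 ltW.
have q1 : q <= 1 by rewrite invf_le1 // lerDl.
have qh : 1 - q <= h.
  rewrite /q -[X in X - _](mulfV (lt0r_neq0 h1)) -{2}[_^-1]mul1r.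
  by rewrite -mulrBl addrAC subrr add0r ler_piMr.
have nu0 : 0 <= nu by rewrite /copies_mean sumr_ge0 // => j _; rewrite exprn_ge0.
have z0 : 0 <= z by rewrite addr_ge0 // !mulr_ge0 // subr_ge0.
suff H j : (j <= n)%N -> E (fun G => (q ^+ j) ^+ K G) * z ^+ j <= 1 by exact: H.
elim: j => [|j IHj] jn.
  rewrite mulr1 -[X in _ <= X](gnp_expect1 (N := N) p); apply: ler_gnp_expect => // G _.
  by rewrite expr1n.
apply: le_trans (IHj (ltnW jn)); rewrite [z ^+ _]exprS mulrA ler_wpM2r ?exprn_ge0 //.
set r := q ^+ j.+1.
have r0 : 0 <= r by rewrite exprn_ge0.
have r1 : r <= 1 by rewrite exprn_ile1.
have qj : q ^+ j = r * (1 + h) by rewrite /r exprSr -mulrA mulVf ?mulr1 // gt_eqF.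
(* The bound [(1 + h) ^+ K >= 1 + h * K] brings in the expectation of [K * r ^+ K], which
   [janson_step] bounds from below. *)
apply: (@le_trans _ _ (E (fun G => r ^+ K G + h * ((K G)%:R * r ^+ K G)))); last first.
  apply: ler_gnp_expect => // G _; rewrite qj exprMn.
  have -> : r ^+ K G + h * ((K G)%:R * r ^+ K G) = r ^+ K G * (1 + h * (K G)%:R).
    by move: (r ^+ _) (K G)%:R => a b; ring.
  by rewrite ler_wpM2l ?exprn_ge0 ?ler1D_exprn.
rewrite gnp_expectD gnp_expectZ.
have phi0 : 0 <= E (fun G => r ^+ K G) by apply: gnp_expect_ge0 => // G; rewrite exprn_ge0.
apply: le_trans (lerD (lexx _) (ler_wpM2l h0 (janson_step p0 p1 FD r0 r1 HC Hp))).
rewrite -[X in _ <= X + _]mul1r [in leRHS]mulrA -mulrDl mulrC ler_wpM2r //.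
rewrite /z lerD2l [in leRHS]mulrA ler_wpM2l ?mulr_ge0 // lerD2l lerN2.
rewrite ler_wpM2l ?mulr_ge0 //.
(* Since [1 - r <= j.+1 * (1 - q) <= n * h], the same factor [z] serves every step. *)
have := bernoulli_exprn j.+1 q0 q1; rewrite lerBlDr -lerBlDl => /le_trans; apply.
rewrite mulrC; apply: ler_pM => //; by rewrite ?subr_ge0 // ler_nat.
Qed.

(** Markov's inequality for [(q ^+ n) ^+ K], where [q] is the inverse of [1 + h] and [h = e / nu].
    The smallness condition on [e] leaves [d / 2] of the relative deviation [d] in the exponent. *)
Lemma copies_lower_tail (C d e : R) n :
  0 <= C -> 0 < nu -> 0 <= e -> d <= 1 ->
  2 * C * (n%:R * (e / nu)) + e <= d / 2 ->
  (forall i, i \in S -> copies_meeting p S F (F i) <= C) ->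
  (forall i j, i \in S -> j \in S -> 2^-1 <= (1 - p) ^+ #|F i :|: F j|) ->
  gnp_pr p (fun G => (K G)%:R <= (1 - d) * nu) <= expR (- (n%:R * (e * (d / 2)))).
Proof.
move=> C0 nu0 e0 d1 ed HC Hp; have hnu : e / nu * nu = e by rewrite divfK // gt_eqF.
have : 0 <= e / nu by rewrite divr_ge0 // ltW.
move: (e / nu) hnu ed => h hnu ed h0.
set eta := 2 * C * (n%:R * h) in ed *.
have eta0 : 0 <= eta by rewrite /eta !mulr_ge0 ?ler0n.
have eta1 : eta <= 1.
  apply: (@le_trans _ _ (d / 2)); last by lra.
  by apply: le_trans ed; rewrite lerDl.
have lap := copies_laplace C0 h0 eta1 HC Hp.
rewrite -/eta hnu in lap.
set q := (1 + h)^-1 in lap.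
have h1 : 0 < 1 + h by rewrite ltr_wpDr.
have q0 : 0 <= q by rewrite invr_ge0 ltW.
have qe : expR (- h) <= q.
  by rewrite expRN lef_pV2 ?posrE ?expR_gt0 // expR_ge1Dx.
(* On this event [h * K <= e * (1 - d)], and [q >= expR (- h)]. *)
have Mk : expR (- (e * (1 - d))) ^+ n * gnp_pr p (fun G => (K G)%:R <= (1 - d) * nu) <=
    E (fun G => (q ^+ n) ^+ K G).
  apply: gnp_markov => // [G|G KG]; first by rewrite !exprn_ge0.
  rewrite -exprM mulnC exprM lerXn2r ?nnegrE ?expR_ge0 ?exprn_ge0 //.
  apply: (@le_trans _ _ (expR (- h) ^+ K G)); last by rewrite lerXn2r ?nnegrE ?expR_ge0.
  rewrite -expRM_natl ler_expR mulrN lerN2 mulrC.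
  apply: le_trans (ler_wpM2l h0 KG) _.
  by rewrite mulrCA hnu mulrC.
have y0 : 0 < 1 + e * (1 - eta) by rewrite ltr_wpDr // mulr_ge0 // subr_ge0.
have {Mk lap} := le_trans (ler_wpM2r (exprn_ge0 n (ltW y0)) Mk) lap.
rewrite expRN exprVn mulrAC mulrC -ler_pdivlMr; last first.
  by rewrite mulr_gt0 ?invr_gt0 ?exprn_gt0 ?expR_gt0.
move=> /le_trans; apply.
rewrite div1r invfM invrK -[X in _ <= expR X]mulrN expRM_natl -exprVn -exprMn lerXn2r //.
- by rewrite nnegrE mulr_ge0 ?expR_ge0 // invr_ge0 ltW.
- by rewrite nnegrE expR_ge0.
by rewrite ler_pdivrMr // [leRHS]mulrC; apply: laplace_step_le.
Qed.

End Tails.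

(** * Triangles as a family of copies *)

Section Triangles.
Context {R : realType} {N : nat}.
Implicit Types (U e f : {set 'I_N}) (A G : {set {set 'I_N}}).

Definition edges_in U : {set {set 'I_N}} :=
  [set e : {set 'I_N} | (e \subset U) && (#|e| == 2)].

Definition triples : {set {set 'I_N}} := [set U : {set 'I_N} | #|U| == 3].

Lemma num_triangles_copies G : num_triangles G = copies triples edges_in G.
Proof.
by apply: eq_card => U; rewrite mem_triangles !inE.
Qed.

Lemma edges_in_subset U : edges_in U \subset all_edges N.
Proof. by apply/subsetP => e; rewrite !inE => /andP[]. Qed.

Lemma card_edges_in U : U \in triples -> #|edges_in U| = 3.
Proof. by rewrite inE cards_draws => /eqP ->. Qed.

Lemma copies_mean_triangles (p : R) :
  copies_mean p triples edges_in = 'C(N, 3)%:R * p ^+ 3.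
Proof.
rewrite /copies_mean (eq_bigr (fun=> p ^+ 3)) => [|U /card_edges_in -> //].
rewrite sumr_const mulr_natl; congr (_ *+ _).
by rewrite card_draws card_ord.
Qed.

Lemma setU_edges_in U e f : U \in triples -> e \in edges_in U -> f \in edges_in U ->
  e != f -> U = e :|: f.
Proof.
rewrite !inE => /eqP U3 /andP[eU /eqP e2] /andP[fU /eqP f2] ef.
apply/esym/eqP; rewrite eqEcard subUset eU fU U3 /=.
suff /proper_card : e \proper e :|: f by rewrite e2.
 rewrite properE subsetUl subUset subxx /=.
by apply: contraNN ef => fe; rewrite eq_sym eqEcard fe e2 f2.
Qed.

Lemma triangles_meeting_le (p : R) A : 0 <= p -> p <= 1 -> N%:R * p ^+ 2 <= 1 ->
  copies_meeting p triples edges_in A <= (2 * #|A| ^ 2)%:R.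
Proof.
move=> p0 p1 Np.
(* [one] covers the triangles with exactly one edge in [A], each of weight [p ^+ 2]; [two] covers
   those with at least two, whose weight is bounded by 1. *)
pose one := [set v |: e | e in A, v in [set: 'I_N]].
pose two := [set e :|: f | e in A, f in A].
have Hone : (#|one| <= #|A| * N)%N.
  rewrite /one curry_imset2X (leq_trans (leq_imset_card _ _)) //.
  by rewrite cardsX cardsT card_ord.
have Htwo : (#|two| <= #|A| ^ 2)%N.
  by rewrite /two curry_imset2X (leq_trans (leq_imset_card _ _)) // cardsX.
apply: (@le_trans _ _ (\sum_U ((U \in one)%:R * p ^+ 2 + (U \in two)%:R))).
  rewrite /copies_meeting big_mkcond /=; apply: ler_sum => U _.
  have rhs0 : 0 <= (U \in one)%:R * p ^+ 2 + (U \in two)%:R.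
    by rewrite addr_ge0 ?mulr_ge0 ?exprn_ge0.
  case: ifP => // /andP[U3 /pred0Pn[e /= /andP[eU eA]]].
  have [/existsP[f /and3P[fU fA ef]]|nf] :=
      boolP [exists f, [&& f \in edges_in U, f \in A & e != f]].
    have -> : U \in two by rewrite (setU_edges_in U3 eU fU ef) imset2_f.
    by rewrite ler_wpDl ?mulr_ge0 ?exprn_ge0 // exprn_ile1.
  have -> : #|edges_in U :\: A| = 2.
    rewrite cardsD card_edges_in // (_ : _ :&: _ = [set e]) ?cards1 //.
    apply/setP => f; rewrite in_setI in_set1; apply/andP/eqP => [[fU fA]|-> //].
    apply/eqP; apply: contraNT nf => fe; apply/existsP; exists f.
    by rewrite fU fA eq_sym.
  suff -> : U \in one by rewrite mul1r lerDl.
  move: eU U3; rewrite !inE => /andP[eU /eqP e2] /eqP U3.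
  have /cards1P[v Uv] : #|U :\: e| == 1 by rewrite cardsD (setIidPr eU) U3 e2.
  apply/imset2P; exists e v; rewrite ?inE //.
  by rewrite -Uv -[LHS](setID U e) (setIidPr eU) setUC.
rewrite big_split /= -mulr_suml -!natr_sum -!big_mkcond /= !sum1_card.
have {}Hone : #|one|%:R * p ^+ 2 <= #|A|%:R :> R.
  apply: (@le_trans _ _ (#|A|%:R * (N%:R * p ^+ 2))); last by rewrite ler_piMr.
  by rewrite mulrA -natrM ler_wpM2r ?exprn_ge0 // ler_nat.
apply: (@le_trans _ _ (#|A| + #|A| ^ 2)%:R).
  by rewrite natrD lerD // ler_nat.
by rewrite ler_nat; case: #|A| => // a; nia.
Qed.

End Triangles.

(** * Numerical estimates and choice of parameters *)

Lemma expn3_le_bin3 N : (6 <= N -> N ^ 3 <= 12 * 'C(N, 3))%N.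
Proof.
move=> N6; have := bin_ffact N 3; rewrite !factS fact0 => binE.
rewrite (_ : 12 * _ = 2 * N ^_ 3)%N; last by rewrite -binE; lia.
case: N N6 {binE} => [|[|n]] // n6; rewrite !ffactSS ffactn1; nia.
Qed.

Lemma truncn_half (R : realType) (x : R) : 1 <= x ->
  (Num.truncn x)%:R <= x /\ x / 2 <= (Num.truncn x)%:R.
Proof.
move=> x1; have x0 : 0 <= x by apply: le_trans x1.
have /andP[tx xt] := truncn_itv x0; split => //.
have : 1 <= (Num.truncn x)%:R :> R by rewrite ler1n truncn_gt0.
by move: xt; rewrite -natr1; move: (_%:R) => t; lra.
Qed.

(** With [y] the eighth root of [N], the mean has order [y ^+ 6], the relative deviation is [y^-1],
    and [m] and [n] are the integer parts of [y ^+ 2] and [y ^+ 3]. The strongest demand on the size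
    of [y] is [18 <= y / 48], in the upper tail. *)
Lemma triangles_tail (R : realType) (N : nat) (y p : R)
    (nu := copies_mean p (@triples N) edges_in) :
  1000 <= y -> N%:R = y ^+ 8 -> p = y ^- 6 ->
  gnp_pr p (fun G : {set {set 'I_N}} => y^-1 * nu <= `|(num_triangles G)%:R - nu|) <=
  2 * expR (- (y / 32)).
Proof.
move=> yB Ny py.
have y0 : 0 < y by move: yB; lra.
have y12 : 12 <= y by move: yB; lra.
have yn0 : y != 0 by rewrite gt_eqF.
have y1 : 1 <= y by move: yB; lra.
have w0 : 0 < y^-1 by rewrite invr_gt0.
have wB : y^-1 <= 12^-1 by rewrite lef_pV2 ?posrE ?ltr0n.
have p0 : 0 < p by rewrite py invr_gt0 exprn_gt0.
have pw : p <= y^-1 by rewrite py lef_pV2 ?posrE ?exprn_gt0 // ler_eXnr.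
(* Six given edges are then absent with probability at least [1 - 6 * p >= 2^-1]. *)
have p12 : p <= 12^-1 by apply: le_trans pw wB.
have p1 : p <= 1 by apply: le_trans p12 _; rewrite invf_le1 ?ler1n.
have Np : N%:R * p ^+ 2 <= 1.
  rewrite Ny py (_ : _ * _ = (y ^+ 4)^-1); last by field.
  by rewrite invf_le1 ?exprn_gt0 // exprn_ege1.
have N6 : (6 <= N)%N.
  rewrite -(ler_nat R) Ny; apply: le_trans (ler_eXnr (n := 8) isT y1).
  by apply: le_trans y12; rewrite ler_nat.
(* The mean is at least [(N * p) ^ 3 / 12], and [N * p = y ^+ 2]. *)
have nuB : y ^+ 6 / 12 <= nu.
  rewrite /nu copies_mean_triangles ler_pdivrMr ?ltr0n // mulrAC -ler_pdivrMr ?exprn_gt0 //.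
  have := expn3_le_bin3 N6; rewrite -(ler_nat R) natrX natrM mulrC Ny; apply: le_trans.
  by rewrite py le_eqVlt; apply/orP; left; apply/eqP; field.
have nu0 : 0 < nu by apply: lt_le_trans nuB; rewrite divr_gt0 ?exprn_gt0 ?ltr0n.
have touch A := triangles_meeting_le A (ltW p0) p1 Np.
have FD (U : {set 'I_N}) : U \in @triples N -> edges_in U \subset all_edges N.
  by move=> _; exact: edges_in_subset.
have F3 (U : {set 'I_N}) : U \in @triples N -> (#|edges_in U| <= 3)%N.
  by move=> /card_edges_in ->.
have w1 : y^-1 <= 1 by rewrite invf_le1.
apply: le_trans (gnp_pr_le_orb (ltW p0) p1
  (B := fun G => (1 + y^-1) * nu <= (copies (@triples N) edges_in G)%:R)
  (C := fun G => (copies (@triples N) edges_in G)%:R <= (1 - y^-1) * nu) _) _.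
  move=> G; rewrite num_triangles_copies ler_normr opprB => /orP[] H; apply/orP.
    by left; move: H; lra.
  by right; move: H; lra.
have [mu_ ml] := truncn_half (exprn_ege1 2 y1).
have [nu_ nl] := truncn_half (exprn_ege1 3 y1).
set m := Num.truncn (y ^+ 2) in mu_ ml; set n := Num.truncn (y ^+ 3) in nu_ nl.
rewrite mulr_natl mulr2n; apply: lerD.
  (* The value [18 * y ^+ 4] is [2 * #|B| ^ 2] at the largest size,
     [#|B| <= 3 * m <= 3 * y ^+ 2]. *)
  apply: (le_trans (@copies_upper_tail R N _ p (@triples N) edges_in (ltW p0) p1 FD
    (18 * y ^+ 4) y^-1 m F3 _ nu0 (ltW w0) w1 _)).
  - move=> B _ Bm; apply: le_trans (touch B) _.
    apply: (@le_trans _ _ (18 * m%:R ^+ 2)).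
      rewrite -natrX -natrM ler_nat (_ : 18 * m ^ 2 = 2 * (3 * m) ^ 2)%N.
        by rewrite leq_pmul2l // leq_exp2r.
      by rewrite expnMn mulnA.
    rewrite ler_wpM2l // (_ : y ^+ 4 = (y ^+ 2) ^+ 2); last by rewrite -exprM.
    by rewrite lerXn2r ?nnegrE ?exprn_ge0 ?(ltW y0).
  - apply: (@le_trans _ _ (y^-1 / 4 * (y ^+ 6 / 12))); last first.
      by rewrite ler_wpM2l // divr_ge0 // ltW.
    rewrite (_ : _ * (_ / 12) = y ^+ 4 * (y / 48)); last by field.
    by rewrite mulrC ler_wpM2l ?exprn_ge0 ?(ltW y0) //; move: yB; lra.
  rewrite ler_expR lerN2; apply: (@le_trans _ _ (y ^+ 2 / 2 * (y^-1 / 3))).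
    rewrite [leRHS](_ : _ = y / 6); last by field.
    by move: y0; lra.
  by rewrite ler_wpM2r // divr_ge0 // ltW.
(* Here [18 = 2 * 3 ^ 2] since a triangle has three edges. With [e = y^-1 / 8] the term
   [2 * C * (n * (e / nu))] is at most [54 / y ^+ 4], so its sum with [e] stays below [y^-1 / 2]. *)
apply: (le_trans (@copies_lower_tail R N _ p (@triples N) edges_in (ltW p0) p1 FD
  18 y^-1 (y^-1 / 8) n _ nu0 _ w1 _ _ _)) => //.
- by rewrite divr_ge0 // ltW.
- have nuw : nu^-1 <= 12 / y ^+ 6.
    by rewrite -[12 / _]invrK invf_div lef_pV2 ?posrE // divr_gt0 ?exprn_gt0.
  apply: (@le_trans _ _ (2 * 18 * (y ^+ 3 * (y^-1 / 8 * (12 / y ^+ 6))) + y^-1 / 8)).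
    have w8 : 0 <= y^-1 / 8 by rewrite divr_ge0 // ltW.
    rewrite lerD2r ler_wpM2l //; apply: ler_pM => //; last by rewrite ler_wpM2l.
    by rewrite (divr_ge0 w8 (ltW nu0)).
  rewrite [leLHS](_ : _ = y^-1 * (54 / y ^+ 3 + 8^-1)); last by field.
  rewrite ler_wpM2l ?(ltW w0) // -lerBrDr ler_pdivrMr ?exprn_gt0 //.
  have : y <= y ^+ 3 by rewrite ler_eXnr.
  by move: yB; lra.
- by move=> U /card_edges_in U3; apply: le_trans (touch _) _; rewrite U3 ler_nat.
- move=> U V /card_edges_in U3 /card_edges_in V3.
  have UV : (#|edges_in U :|: edges_in V| <= 6)%N.
    by rewrite (leq_trans (leq_card_setU _ _)) // U3 V3.
  apply: (@le_trans _ _ ((1 - p) ^+ 6)); last first.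
    by rewrite ler_wiXn2l ?subr_ge0 // gerBl ltW.
  have q0 : 0 <= 1 - p by rewrite subr_ge0.
  have q1 : 1 - p <= 1 by rewrite gerBl ltW.
  apply: le_trans (bernoulli_exprn 6 q0 q1).
  by move: p12; lra.
rewrite ler_expR lerN2; apply: (@le_trans _ _ (y ^+ 3 / 2 * (y^-1 / 8 * (y^-1 / 2)))).
  by rewrite [leRHS](_ : _ = y / 32) //; field.
by rewrite ler_wpM2r // !mulr_ge0 // ltW.
Qed.

(** * Asymptotics in [N] and conclusion *)

Local Open Scope classical_set_scope.
Local Open Scope ring_scope.

Lemma near_infty_powR_ge (R : realType) (a c : R) : 0 < a ->
  \forall N \near \oo, c <= N%:R `^ a.
Proof.
move=> a0; near=> N.
have cN : `|c| `^ a^-1 <= N%:R by near: N; exact: nbhs_infty_ger.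
apply: le_trans (ler_norm c) _.
rewrite -[`|c|]powRr1 // -[X in `|c| `^ X](@mulVf _ a) ?gt_eqF // powRrM.
by rewrite ge0_ler_powR ?nnegrE ?powR_ge0 // ltW.
Unshelve. all: by end_near. Qed.

Lemma edge_probE (R : realType) (N : nat) : edge_prob R N = (N%:R `^ (1 / 8)) ^- 6.
Proof.
rewrite /edge_prob powRN -powR_mulrn ?powR_ge0 // -powRrM.
by congr ((_ `^ _)^-1); field.
Qed.

Lemma mu_copies_mean (R : realType) (N : nat) :
  mu R N = copies_mean (edge_prob R N) (@triples N) edges_in.
Proof. by rewrite muE copies_mean_triangles. Qed.

Theorem mainTheorem2 (R : realType) :
  exists (t : nat -> R^o) (N0 : nat),
    [/\ forall N : nat, (3 <= N)%N -> 0 < t N,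
        t =o_\oo (mu R : nat -> R^o)
      & forall N : nat, (3 <= N)%N -> (N0 <= N)%N ->
          gnp_pr (edge_prob R N)
            (fun G : {set {set 'I_N}} => t N <= `|(num_triangles G)%:R - mu R N|)
          < expR (- (N%:R `^ (1 / 13)))].
Proof.
have c0 : 0 < 1 / 8 :> R by lra.
(* This exponent is [1 / 8 - 1 / 13]: once [N] to the power [5 / 104] reaches 64, [N ^ (1 / 8)] is
   at least [64 * N ^ (1 / 13)]. *)
have c1 : 0 < 5 / 104 :> R by lra.
have c2 : 0 < 1 / 13 :> R by lra.
have [N1 _ H1] := near_infty_powR_ge 1000 c0.
have [N2 _ H2] := near_infty_powR_ge 64 c1.
have [N3 _ H3] := near_infty_powR_ge 2 c2.
exists (fun N => (N%:R `^ (1 / 8))^-1 * mu R N), (maxn N1 (maxn N2 N3)).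
split=> [N N3'||N N3'].
- have N0 : 0 < N%:R :> R by rewrite ltr0n (leq_trans _ N3').
  rewrite mulr_gt0 ?invr_gt0 ?powR_gt0 // muE mulr_gt0 ?ltr0n ?bin_gt0 //.
  by rewrite exprn_gt0 // powR_gt0.
- apply/eqoP => e e0; near=> N.
  rewrite normrM ler_wpM2r // normfV ger0_norm ?powR_ge0 //.
  have eN : e^-1 <= N%:R `^ (1 / 8) by near: N; exact: near_infty_powR_ge.
  by rewrite -[leRHS]invrK lef_pV2 ?posrE ?invr_gt0 // (lt_le_trans _ eN) ?invr_gt0.
rewrite !geq_max => /and3P[/H1/= y1 /H2/= y2 /H3/= z2].
rewrite mu_copies_mean; set p := edge_prob R N.
have Ny : N%:R = (N%:R `^ (1 / 8)) ^+ 8 :> R.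
  rewrite -powR_mulrn ?powR_ge0 // -powRrM (_ : 1 / 8 * 8%:R = 1) ?powRr1 //.
  by field.
apply: le_lt_trans (triangles_tail y1 Ny (edge_probE R N)) _.
have yz : 64 * N%:R `^ (1 / 13) <= N%:R `^ (1 / 8) :> R.
  apply: le_trans (ler_wpM2r (powR_ge0 _ _) y2) _.
  rewrite -powRD; last by apply/implyP => _; rewrite pnatr_eq0 -lt0n (leq_trans _ N3').
  by rewrite (_ : _ + _ = 1 / 8 :> R) //; field.
move: (N%:R `^ (1 / 13)) (N%:R `^ (1 / 8)) z2 yz => z y z2 yz.
(* Since [y / 32 >= 2 * z], one factor [expR (- z)] is left to absorb the 2, as
   [expR z >= 1 + z > 2]. *)
apply: (@le_lt_trans _ _ (2 * expR (- z + - z))).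
  by rewrite ler_wpM2l // ler_expR; lra.
rewrite expRD mulrA gtr_pMl ?expR_gt0 // expRN ltr_pdivrMr ?expR_gt0 // mul1r.
by apply: lt_le_trans (expR_ge1Dx z); lra.
Unshelve. all: by end_near. Qed.
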